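(* For each natural number $n\ge 3$, there exists at least one $2n$-dimensional SKT Lie algebra $(\mathfrak g,J,\langle\cdot,\cdot\rangle)$, with $\mathfrak g$ nilpotent, whose complex structure $J$ is non-abelian.
   Context: All Lie algebras are finite-dimensional and real. A Hermitian Lie algebra is a triple $(\mathfrak g,J,\langle\cdot,\cdot\rangle)$ where $\mathfrak g$ is a real Lie algebra, $J:\mathfrak g\to\mathfrak g$ is a complex structure, i.e. is linear with $J^2=-\mathrm{Id}$ and satisfies $[JX,JY]=[X,Y]+J[JX,Y]+J[X,JY]$ for all $X,Y$, and $\langle\cdot,\cdot\rangle$ is an inner product with $\langle J\cdot,J\cdot\rangle=\langle\cdot,\cdot\rangle$. Its Bismut torsion $3$-form is $$c(U,Y,Z)=-\langle[JU,JY],Z\rangle-\langle[JY,JZ],U\rangle-\langle[JZ,JU],Y\rangle,$$ with exterior derivative $$dc(W,U,Y,Z)=-c([W,U],Y,Z)+c([W,Y],U,Z)-c([W,Z],U,Y)-c([U,Y],W,Z)+c([U,Z],W,Y)-c([Y,Z],W,U).$$ $(\mathfrak g,J,\langle\cdot,\cdot\rangle)$ is called SKT if $dc=0$. The complex structure $J$ is called abelian if $[JX,JY]=[X,Y]$ for all $X,Y\in\mathfrak g$, and non-abelian otherwise. *)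

(* Defs.v *)
From HB Require Import structures.
From mathcomp Require Import all_boot all_order all_algebra.
From mathcomp Require Import reals.

Set Implicit Arguments.
Unset Strict Implicit.
Unset Printing Implicit Defensive.
Import Order.TTheory GRing.Theory Num.Theory.
Local Open Scope ring_scope.

Record lieAlgebra (K : fieldType) := LieAlgebra {
  lie_space :> vectType K;
  lie : {bilinear lie_space -> lie_space -> lie_space};
  lie_alternating : forall x, lie x x = 0;
  lie_jacobi : forall x y z,
    lie x (lie y z) + lie y (lie z x) + lie z (lie x y) = 0
}.

Arguments lie {K l}.

Section LowerCentralSeries.
Variables (K : fieldType) (g : lieAlgebra K).
Implicit Types U V W : {vspace g}.

(* [U, V] is spanned by the brackets of basis vectors; the two lemmas below
   show that it is the smallest subspace containing all the [u, v] with u in U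
   and v in V. *)
Definition lie_prod U V : {vspace g} :=
  <<[seq lie u v | u <- vbasis U, v <- vbasis V]>>%VS.

Lemma mem_lie_prod U V u v : u \in U -> v \in V -> lie u v \in lie_prod U V.
Proof.
move=> /coord_vbasis-> /coord_vbasis->.
rewrite linear_sumlz; apply: rpred_sum => i _.
rewrite linear_sumr; apply: rpred_sum => j _.
by rewrite linearZr_LR linearZl_LR !rpredZ //; apply/memv_span/allpairs_f;
  rewrite mem_nth // size_tuple.
Qed.

Lemma lie_prod_subv U V W :
  {in U & V, forall u v, lie u v \in W} -> (lie_prod U V <= W)%VS.
Proof.
move=> UVW; apply/span_subvP => _ /allpairsP[[u v] /= [uU vV ->]].
by apply: UVW; exact: vbasis_mem.
Qed.

Fixpoint lower_central k : {vspace g} :=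
  if k is k'.+1 then lie_prod fullv (lower_central k') else fullv.

Definition nilpotent_lie := exists k, lower_central k = 0%VS.

End LowerCentralSeries.

Arguments nilpotent_lie {K} g.

Definition complex_structure (K : fieldType) (g : lieAlgebra K)
    (J : {linear g -> g}) :=
  (forall x, J (J x) = - x) /\
  (forall x y, lie (J x) (J y) = lie x y + J (lie (J x) y) + J (lie x (J y))).

Record hermitianLieAlgebra (R : realType) := HermitianLieAlgebra {
  hermitian_lie :> lieAlgebra R;
  cstruct : {linear hermitian_lie -> hermitian_lie};
  inner : {dot hermitian_lie for idfun};
  cstructP : complex_structure cstruct;
  inner_cstruct : forall x y, inner (cstruct x) (cstruct y) = inner x y
}.

Arguments cstruct {R h}.
Arguments inner {R h}.

Section Torsion.
Variables (R : realType) (g : hermitianLieAlgebra R).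
Local Notation J := (@cstruct R g).
Implicit Types W U Y Z : g.

Definition bismut_torsion U Y Z : R :=
  - inner (lie (J U) (J Y)) Z - inner (lie (J Y) (J Z)) U
  - inner (lie (J Z) (J U)) Y.

Local Notation c := bismut_torsion.

Definition d_bismut_torsion W U Y Z : R :=
  - c (lie W U) Y Z + c (lie W Y) U Z - c (lie W Z) U Y
  - c (lie U Y) W Z + c (lie U Z) W Y - c (lie Y Z) W U.

Definition SKT := forall W U Y Z, d_bismut_torsion W U Y Z = 0.

Definition abelian_cstruct := forall x y : g, lie (J x) (J y) = lie x y.

End Torsion.

Arguments SKT {R} g.
Arguments abelian_cstruct {R} g.

(* Main.v *)
(** Over C^n take z1, z2, z3 to be three complex coordinates and bracket
    two vectors z, w into the z3-axis by
      [z, w] = (z1 w2 - z2 w1) + Im (z1 conj(w1)) + 2 Im (z2 conj(w2)).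
    The z3-axis is central, so this is a 2-step nilpotent Lie algebra. The first
    term is complex bilinear and makes J = i non-abelian; the two others are
    J-invariant. By centrality dc is alternating and only sees z1, z2, so its
    one coefficient is a multiple of |lambda|^2 - mu nu / 2 when the three terms
    are weighted by lambda, mu, nu; the weights 1, 1, 2 make it vanish. *)
From HB Require Import structures.
Require Import Defs.
From mathcomp Require Import all_boot all_order all_algebra.
From mathcomp Require Import reals.
From mathcomp Require Import ring lra.

Import GRing.Theory Num.Theory.

Section FrobeniusProduct.
Local Open Scope ring_scope.
Variables (R : realFieldType) (m n : nat).
Implicit Types A B : 'M[R]_(m, n).

Definition frobenius A B : R := \tr (A *m B^T).

Lemma frobenius_bilinear :
  bilinear_for (GRing.Scale.Law.clone R R *%R _)
    (GRing.Scale.Law.clone R R (idfun \; *%R) _) frobenius.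
Proof.
split=> [B|A] a X Y; rewrite /frobenius.
  by rewrite mulmxDl -scalemxAl linearP.
by rewrite linearP /= mulmxDr -scalemxAr linearP.
Qed.

HB.instance Definition _ :=
  @bilinear_isBilinear.Build R _ _ _ _ _ frobenius frobenius_bilinear.

Lemma frobenius_sym A B : frobenius A B = (-1) ^+ false * idfun (frobenius B A).
Proof. by rewrite mul1r /= /frobenius -mxtrace_tr trmx_mul trmxK. Qed.

HB.instance Definition _ :=
  @isHermitianSesquilinear.Build R _ false idfun frobenius frobenius_sym.

Lemma frobenius_gt0 A : A != 0 -> 0 < frobenius A A.
Proof.
have entry_ge0 i j : 0 <= A i j * A^T j i by rewrite mxE -expr2 sqr_ge0.
have row_ge0 i : 0 <= \sum_j A i j * A^T j i by apply: sumr_ge0.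
have -> : frobenius A A = \sum_i \sum_j A i j * A^T j i.
  by apply: eq_bigr => i _; rewrite mxE.
rewrite lt0r sumr_ge0 ?andbT; last by [].
apply: contraNneq => /eqP; rewrite psumr_eq0 // => /allP sum0.
apply/eqP/matrixP => i j; rewrite mxE.
move: (sum0 i (mem_index_enum i)); rewrite /= psumr_eq0 // => /allP.
by move=> /(_ j (mem_index_enum j)); rewrite mxE mulf_eq0 orbb => /eqP.
Qed.

HB.instance Definition _ :=
  @isDotProduct.Build R _ frobenius frobenius_gt0.

Lemma frobenius_delta i j B : frobenius (delta_mx i j) B = B i j.
Proof.
rewrite /frobenius /mxtrace (bigD1 i) //= mxE (bigD1 j) //= !mxE !eqxx mul1r.
rewrite !big1 ?addr0 // => [i' ni|j' nj]; last first.
  by rewrite !mxE (negPf nj) andbF mul0r.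
by rewrite mxE big1 // => k _; rewrite mxE (negPf ni) mul0r.
Qed.

End FrobeniusProduct.

Arguments frobenius {R m n}.

(** C^n is encoded as the space of 2 x n real matrices whose rows are the real
    and imaginary parts. *)
Section Example.
Local Open Scope ring_scope.
Variables (R : realType) (n : nat) (p q r : 'I_n).
Hypotheses (rp : r != p) (rq : r != q).
Notation V := 'M[R]_(2, n).
Implicit Types A B C D : V.

Lemma sum_ord2 (F : 'I_2 -> R) : \sum_i F i = F 0 + F 1.
Proof.
by rewrite big_ord_recl big_ord1; congr (_ + F _); apply: val_inj.
Qed.

(** Left multiplication by this quarter turn sends each column x + i y to -y + i x. *)
Definition rot_mx : 'M[R]_2 := delta_mx 1 0 - delta_mx 0 1.
Definition mulI : V -> V := mulmx rot_mx.

HB.instance Definition _ := GRing.Linear.on mulI.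

Lemma mulI0 A j : mulI A 0 j = - A 1 j.
Proof.
by rewrite mxE sum_ord2 !mxE /=; ring.
Qed.

Lemma mulI1 A j : mulI A 1 j = A 0 j.
Proof.
by rewrite mxE sum_ord2 !mxE /=; ring.
Qed.

Lemma eq_rows A B : A 0 =1 B 0 -> A 1 =1 B 1 -> A = B.
Proof.
move=> e0 e1; apply/matrixP => i j.
by have [->|->] : i = 0 \/ i = 1
  by case: i => [[|[|//]]] ?; [left|right]; apply: val_inj.
Qed.

Lemma mulIK A : mulI (mulI A) = - A.
Proof.
by apply: eq_rows => j; rewrite [RHS]mxE ?mulI0 ?mulI1 // mulI0.
Qed.

Lemma frobenius_mulI A B : frobenius (mulI A) (mulI B) = frobenius A B.
Proof.
rewrite /frobenius /mxtrace !sum_ord2 !mxE.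
(* [mulI] exchanges the two rows up to sign, so the row sums are matched crosswise. *)
rewrite addrC; congr (_ + _); apply: eq_bigr => j _; rewrite ![_^T _ _]mxE.
  by rewrite !mulI1.
by rewrite !mulI0 mulrNN.
Qed.

(** Columns [p], [q], [r] hold z1, z2, z3. The two [Im] terms are real, so they enter here and not
    in [bracket_im]. *)
Definition bracket_re A B : R :=
  A 0 p * B 0 q - A 1 p * B 1 q - A 0 q * B 0 p + A 1 q * B 1 p
  + (A 1 p * B 0 p - A 0 p * B 1 p) + 2 * (A 1 q * B 0 q - A 0 q * B 1 q).

Definition bracket_im A B : R :=
  A 0 p * B 1 q + A 1 p * B 0 q - A 0 q * B 1 p - A 1 q * B 0 p.

Definition bracket A B : V :=
  bracket_re A B *: delta_mx 0 r + bracket_im A B *: delta_mx 1 r.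

Lemma bracket_bilinear :
  bilinear_for (GRing.Scale.Law.clone R V *:%R _)
    (GRing.Scale.Law.clone R V *:%R _) bracket.
Proof.
split=> [B|A] a X Y; apply/matrixP => i j;
  rewrite /bracket /bracket_re /bracket_im !mxE; ring.
Qed.

HB.instance Definition _ :=
  @bilinear_isBilinear.Build R _ _ _ _ _ bracket bracket_bilinear.

Lemma bracket_alternating A : bracket A A = 0.
Proof.
by apply/matrixP => i j; rewrite /bracket /bracket_re /bracket_im !mxE; ring.
Qed.

Lemma bracket_p A B i : bracket A B i p = 0.
Proof. by rewrite !mxE [p == r]eq_sym (negPf rp) !andbF !mulr0 addr0. Qed.

Lemma bracket_q A B i : bracket A B i q = 0.
Proof. by rewrite !mxE [q == r]eq_sym (negPf rq) !andbF !mulr0 addr0. Qed.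

(** The bracket reads only columns [p] and [q], where every bracket vanishes. *)
Lemma bracket_bracketr A B C : bracket A (bracket B C) = 0.
Proof.
rewrite /bracket [bracket_re A _]/bracket_re [bracket_im A _]/bracket_im.
rewrite -/(bracket B C) !(bracket_p, bracket_q) !mulr0 !(subrr, addr0, mulr0).
by rewrite !scale0r addr0.
Qed.

Lemma bracket_mulI_bracketr A B C : bracket A (mulI (bracket B C)) = 0.
Proof.
rewrite /bracket [bracket_re A _]/bracket_re [bracket_im A _]/bracket_im.
rewrite -/(bracket B C) !(mulI0, mulI1) !(bracket_p, bracket_q) oppr0 !mulr0.
by rewrite !(subrr, addr0, mulr0) !scale0r addr0.
Qed.

Lemma bracketC A B : bracket A B = - bracket B A.
Proof.
by apply/matrixP => i j; rewrite /bracket /bracket_re /bracket_im !mxE; ring.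
Qed.

Lemma bracket_jacobi A B C :
  bracket A (bracket B C) + bracket B (bracket C A) + bracket C (bracket A B)
  = 0.
Proof. by rewrite !bracket_bracketr !addr0. Qed.

Definition example_lie : lieAlgebra R :=
  @LieAlgebra R V bracket bracket_alternating bracket_jacobi.

(** On the complex bilinear part, [JX,JY], J[JX,Y] and J[X,JY] all equal -[X,Y]; on the J-invariant
    part, [JX,Y] = -[X,JY], so the last two terms cancel. *)
Lemma mulI_complex_structure :
  @complex_structure R example_lie mulI.
Proof.
split=> [A|A B]; first exact: mulIK.
rewrite /lie /=; apply: eq_rows => j;
  rewrite [RHS]mxE [X in X + _]mxE !(mulI0, mulI1);
  rewrite /bracket /bracket_re /bracket_im !(mulI0, mulI1) !mxE /=; ring.
Qed.

Definition example : hermitianLieAlgebra R :=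
  @HermitianLieAlgebra R example_lie mulI frobenius
    mulI_complex_structure frobenius_mulI.

Lemma dim_example : \dim {: example} = (2 * n)%N.
Proof. by rewrite dimvf dim_matrix. Qed.

Lemma nilpotent_example : nilpotent_lie example.
Proof.
exists 2; apply/eqP; rewrite -subv0; apply: lie_prod_subv => A B _.
(* Elements of the derived algebra are only sums of brackets; the kernel of ad [A] is a subspace, so
   testing it on brackets suffices. *)
suff /subvP sub1 :
  (lower_central example 1 <= lker (linfun (@lie R example A)))%VS.
  by move=> /sub1; rewrite memv_ker lfunE /= memv0.
apply: lie_prod_subv => C D _ _.
by rewrite memv_ker lfunE /= bracket_bracketr.
Qed.

(** The other two terms bracket with J of a central bracket, which is again central. Every term of
    dc has this shape. *)
Lemma bismut_torsion_bracketl A B C D :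
  @bismut_torsion R example (bracket A B) C D =
  - frobenius (bracket (mulI C) (mulI D)) (bracket A B).
Proof.
rewrite /bismut_torsion /lie /=.
rewrite [bracket (mulI (bracket A B)) _]bracketC !bracket_mulI_bracketr.
by rewrite oppr0 /frobenius !mul0mx mxtrace0 oppr0 add0r addr0.
Qed.

Lemma frobenius_bracket A B C D :
  frobenius (bracket A B) (bracket C D) =
  bracket_re A B * bracket_re C D + bracket_im A B * bracket_im C D.
Proof.
rewrite {1}/bracket /frobenius mulmxDl -!scalemxAl linearD !linearZ /=.
rewrite -!/(frobenius (delta_mx _ _) _) !frobenius_delta !mxE !eqxx /=.
by rewrite !mulr1 !mulr0 addr0 add0r.
Qed.

Lemma SKT_example : SKT example.
Proof.
move=> W U Y Z; rewrite /d_bismut_torsion /lie /= !bismut_torsion_bracketl.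
(* On e1, i e1, e2, i e2 the products of [Im] terms give 2 * (1 * 2), and the four complex bilinear
   products give -4. *)
rewrite !frobenius_bracket /bracket_re /bracket_im !(mulI0, mulI1); ring.
Qed.

Lemma nonabelian_example : p != q -> ~ abelian_cstruct example.
Proof.
(* e1 and i e2 bracket to i on the z3-axis, their images i e1 and -e2 to -i; the imaginary entry
   tells them apart. *)
move=> pq /(_ (delta_mx 0 p) (delta_mx 1 q)) /matrixP /(_ 1 r).
rewrite /lie /= !mxE /bracket_re /bracket_im !(mulI0, mulI1) !mxE.
rewrite !eqxx [q == p]eq_sym (negPf pq) /=; lra.
Qed.

End Example.

Theorem proposition5p13 (R : realType) (n : nat) (hn : (3 <= n)%N) :
  exists g : hermitianLieAlgebra R,
    [/\ \dim {: g} = (2 * n)%N, nilpotent_lie g, SKT g & ~ abelian_cstruct g].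
Proof.
(* The n - 3 columns after the first three form an abelian factor. *)
pose p : 'I_n := Ordinal (leq_trans (isT : 0 < 3) hn).
pose q : 'I_n := Ordinal (leq_trans (isT : 1 < 3) hn).
pose r : 'I_n := Ordinal (leq_trans (isT : 2 < 3) hn).
exists (@example R n p q r isT isT); split.
- exact: dim_example.
- exact: nilpotent_example.
- exact: SKT_example.
- exact: nonabelian_example.
Qed.
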